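(* For every Noetherian space $X$, $\mathrm{sob}(\mathcal{H}_{0\mathsf{V}} X) = ||X|| + 1$ and $\mathrm{rsob}(\mathcal{H}_{0\mathsf{V}} X) = ||X||$.
   Context: A topological space is Noetherian if every open subset is compact (every open cover has a finite subcover; no separation is required). For a well-founded poset $P$ and $x \in P$, $\mathrm{rk}_P(x) = \sup_{x' < x} (\mathrm{rk}_P(x')+1)$ and the ordinal rank of $P$ is $|P| = \sup_{x \in P} (\mathrm{rk}_P(x)+1)$, where $\sup\emptyset = 0$. $\mathcal{H}_0 X$ is the poset of all closed subsets of $X$ (including $\emptyset$), ordered by inclusion; it is well-founded when $X$ is Noetherian. The stature of a Noetherian space $X$ is $||X|| = |\mathcal{H}_0 X| - 1$, equivalently $||X|| = \mathrm{rk}_{\mathcal{H}_0 X}(X)$. A closed subset $C$ of $X$ is irreducible if it is non-empty and, whenever $C \subseteq F_1 \cup F_2$ with $F_1, F_2$ closed in $X$, we have $C \subseteq F_1$ or $C \subseteq F_2$. $\mathcal{S} X$ is the poset of irreducible closed subsets of $X$, ordered by inclusion. The sobrification rank of a Noetherian space $X$ is $\mathrm{sob}\, X = |\mathcal{S} X|$. When $X$ is non-empty, $\mathrm{sob}\, X$ is a successor ordinal and the reduced sobrification rank $\mathrm{rsob}\, X$ is $\mathrm{sob}\, X - 1$ (the ordinal whose successor is $\mathrm{sob}\, X$). The lifted Hoare powerspace $\mathcal{H}_{0\mathsf{V}} X$ is the set of all closed subsets of $X$ (including $\emptyset$) with the lower Vietoris topology, which has as subbase the sets $\Diamond U = \{F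 \text{ closed in } X \mid F \cap U \neq \emptyset\}$, $U$ ranging over the open subsets of $X$. It is Noetherian when $X$ is. *)

(* Defs.v *)
From Stdlib Require Import Inverse_Image.
From HB Require Import structures.
From mathcomp Require Import all_boot finmap.
From mathcomp Require Import all_classical topology.

Set Implicit Arguments.
Unset Strict Implicit.
Unset Printing Implicit Defensive.

Local Open Scope classical_set_scope.

(** * Ordinals

    The tree [OTree f] stands for the ordinal sup_i (f i + 1); every ordinal
    of cardinality bounded by the universe of the index types is obtained in
    this way, and two trees denote the same ordinal when each one is below the
    other. The type [ord] is the quotient of the trees by that equivalence, so
    that equality of ordinals is Leibniz equality. The quotient is made of
    equivalence classes rather than of a [choiceType] quotient, because the
    type of trees lives one universe above the index types. *)

Inductive otree := OTree (I : Type) of I -> otree.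

Fixpoint tle (t u : otree) : Prop :=
  match t, u with
  | OTree A f, OTree B g => forall i : A, exists j : B, tle (f i) (g j)
  end.

Definition teq (t u : otree) : Prop := tle t u /\ tle u t.

Record ord := Ord {
  oclass : otree -> Prop;
  oclassP : exists t, oclass = teq t
}.

Definition opi (t : otree) : ord := Ord (ex_intro _ t erefl).

Definition orepr (a : ord) : otree := sval (cid (oclassP a)).

Definition ole (a b : ord) : Prop := tle (orepr a) (orepr b).

Definition osucc (a : ord) : ord := opi (OTree (fun _ : unit => orepr a)).

Definition olt (a b : ord) : Prop := ole (osucc a) b.

Definition oidx (t : otree) : Type := match t with OTree A _ => A end.

Definition obranch (t : otree) : oidx t -> otree :=
  match t with OTree _ f => f end.

(* The least upper bound of a family; it is the ordinal 0 when [I] is empty. *)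
Definition osup (I : Type) (f : I -> ord) : ord :=
  opi (OTree (fun p : {i : I & oidx (orepr (f i))} => obranch (projT2 p))).

(* The ordinal whose successor is [a]; 0 by convention if there is none. *)
Definition opred (a : ord) : ord :=
  match pselect (exists b, osucc b = a) with
  | left h => sval (cid h)
  | right _ => osup (fun v : void => match v with end)
  end.

Lemma tle_refl t : tle t t.
Proof. by elim: t => I f IH /= i; exists i. Qed.

Lemma tle_trans t u v : tle t u -> tle u v -> tle t v.
Proof.
elim: t u v => I f IH [J g] [K h] /= fg gh i.
have [j fgj] := fg i; have [k ghk] := gh j.
by exists k; apply: IH fgj ghk.
Qed.

Lemma tle_total t u : tle t u \/ tle u t.
Proof.
elim: t u => I f IH [J g].
have [|/existsNP[i /forallNP nfg]] := pselect (tle (OTree f) (OTree g)).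
  by left.
by right => j; exists i; have [/nfg|] := IH i (g j).
Qed.

Lemma opi_eq t u : teq t u -> opi t = opi u.
Proof.
move=> [tu ut]; rewrite /opi.
suff E : teq t = teq u.
  by move: (ex_intro _ t _); rewrite E => p; congr Ord; exact: Prop_irrelevance.
apply/funext => v; apply/propext; split => -[h k]; split.
- exact: tle_trans ut h.
- exact: tle_trans k tu.
- exact: tle_trans tu h.
- exact: tle_trans k ut.
Qed.

Lemma oreprK a : opi (orepr a) = a.
Proof.
rewrite /orepr; case: a => c h /=; case: cid => t /= E.
by rewrite /opi; subst c; congr Ord; exact: Prop_irrelevance.
Qed.

Lemma opiK t : teq t (orepr (opi t)).
Proof.
rewrite /orepr; case: cid => u /= E.
suff : teq t u by [].
by rewrite E; split; exact: tle_refl.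
Qed.

Lemma ole_opi t u : ole (opi t) (opi u) <-> tle t u.
Proof.
have [[a b] [c d]] := (opiK t, opiK u); split => h.
- by apply: tle_trans a _; apply: tle_trans h _.
- by apply: tle_trans b _; apply: tle_trans h _.
Qed.

Lemma ole_refl a : ole a a.
Proof. exact: tle_refl. Qed.

Lemma ole_trans a b c : ole a b -> ole b c -> ole a c.
Proof. exact: tle_trans. Qed.

Lemma ole_antisym a b : ole a b -> ole b a -> a = b.
Proof. by move=> ab ba; rewrite -(oreprK a) -(oreprK b); exact: opi_eq. Qed.

Lemma ole_total a b : ole a b \/ ole b a.
Proof. exact: tle_total. Qed.

Lemma olt_opi a (I : Type) (f : I -> otree) :
  olt a (opi (OTree f)) <-> exists i, ole a (opi (f i)).
Proof.
rewrite /olt /osucc ole_opi /=; split => [/(_ tt)|] [i h].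
  by exists i; rewrite -(oreprK a) ole_opi.
by move=> _; exists i; move: h; rewrite -{1}(oreprK a) ole_opi.
Qed.

Lemma olt_wf : well_founded olt.
Proof.
move=> a; rewrite -(oreprK a); elim: (orepr a) => I f IH.
split => b /olt_opi[i bi]; split => c cb.
by apply: (Acc_inv (IH i)); apply: ole_trans cb bi.
Qed.

Lemma olt_succ a : olt a (osucc a).
Proof. exact: ole_refl. Qed.

Lemma olt_irr a : ~ olt a a.
Proof. by elim: (olt_wf a) => {}a _ IH aa; exact: (IH a aa aa). Qed.

Lemma ole_succ a : ole a (osucc a).
Proof.
have [//|h] := ole_total a (osucc a).
by case: (@olt_irr a); apply: ole_trans h _; exact: ole_refl.
Qed.

Lemma ole_succ2 a b : ole (osucc a) (osucc b) <-> ole a b.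
Proof.
split => [/olt_opi[_]|ab]; first by rewrite oreprK.
by apply/olt_opi; exists tt; rewrite oreprK.
Qed.

Lemma osucc_inj : injective osucc.
Proof.
by move=> a b ab; apply: ole_antisym; apply/ole_succ2; rewrite ab; exact: ole_refl.
Qed.

Lemma osuccK : cancel osucc opred.
Proof.
move=> a; rewrite /opred; case: pselect => [h|[]]; last by exists a.
by case: cid => b /= /osucc_inj.
Qed.

Lemma osup_ub (I : Type) (f : I -> ord) i : ole (f i) (osup f).
Proof.
rewrite -{1}(oreprK (f i)) /osup ole_opi.
case E : {1}(orepr (f i)) => [J g] /= j.
have [j' e] : exists j' : oidx (orepr (f i)), obranch j' = g j.
  by rewrite E; exists j.
by exists (existT _ i j') => /=; rewrite e; exact: tle_refl.
Qed.

Lemma osup_le (I : Type) (f : I -> ord) b :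
  (forall i, ole (f i) b) -> ole (osup f) b.
Proof.
move=> fb; rewrite -(oreprK b) ole_opi.
case E : (orepr b) => [J g] -[i j] /=.
have := fb i; rewrite /ole E.
by case: (orepr (f i)) j => K h /= k /(_ k).
Qed.

(** * Ranks in well-founded posets

    Posets are given by their strict order [lt]. *)

Definition rank (T : Type) (lt : T -> T -> Prop) (wf : well_founded lt) :
    T -> ord :=
  Fix wf (fun=> ord) (fun x rec =>
    osup (fun y : {y | lt y x} => osucc (rec (sval y) (svalP y)))).

Definition ordinal_rank (T : Type) (lt : T -> T -> Prop)
    (wf : well_founded lt) : ord :=
  osup (fun x => osucc (rank wf x)).

Lemma rankE (T : Type) (lt : T -> T -> Prop) (wf : well_founded lt) x :
  rank wf x = osup (fun y : {y | lt y x} => osucc (rank wf (sval y))).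
Proof.
rewrite /rank Fix_eq // => {}x f g fg; congr osup.
by apply/funext => y; rewrite fg.
Qed.

(** * Noetherian spaces *)

Definition noetherian (X : topologicalType) : Prop :=
  forall U : set X, open U -> cover_compact U.

(* The closed subsets of [X], the empty set included. *)
Record hoare0 (X : topologicalType) := Hoare0 {
  hoare0_set :> set X;
  hoare0_closed : closed hoare0_set
}.

Definition hoare0_lt (X : topologicalType) (A B : hoare0 X) : Prop :=
  (A : set X) `<` (B : set X).

Lemma hoare0_inj (X : topologicalType) (A B : hoare0 X) :
  (A : set X) = (B : set X) -> A = B.
Proof.
case: A B => [A cA] [B cB] /= E; subst B.
by congr Hoare0; exact: Prop_irrelevance.
Qed.

Lemma hoare0_wf (X : topologicalType) :
  noetherian X -> well_founded (@hoare0_lt X).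
Proof.
move=> nX C; apply: contrapT => nC.
pose T := {D : hoare0 X | ~ Acc (@hoare0_lt X) D}.
have step (D : T) : {E : T | hoare0_lt (sval E) (sval D)}.
  apply: cid; case: D => D nD; apply: contrapT => h; apply: (nD); split => E ED.
  by apply: contrapT => nE; apply: h; exists (exist _ E nE).
have decr (f : nat -> T) : (forall n, hoare0_lt (sval (f n.+1)) (sval (f n))) ->
    forall m n, m <= n -> (sval (f n) : set X) `<=` (sval (f m) : set X).
  move=> fS m; elim=> [|n IH]; first by rewrite leqn0 => /eqP ->.
  rewrite leq_eqVlt => /predU1P[->//|]; rewrite ltnS => /IH; apply: subset_trans.
  by have [] := fS n.
pose f n := iter n (fun D => sval (step D)) (exist _ C nC).
have fS n : hoare0_lt (sval (f n.+1)) (sval (f n)).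
  by rewrite /f iterS; case: (step _).
pose U n := ~` (sval (f n) : set X).
have oU n : open (U n) by apply: closed_openC; exact: hoare0_closed.
have oV : open (\bigcup_n U n) by apply: bigcup_open => n _.
have [D _ DU] := nX _ oV _ setT U (fun n _ => oU n) (@subset_refl _ _).
pose N := (\max_(n <- enum_fset D) n)%N.
have sN : (sval (f N) : set X) `<=` (sval (f N.+1) : set X).
  move=> x xN; apply: contrapT => xS.
  have [|n /= nD] := DU x; first by exists N.+1.
  apply; apply: (decr f fS n N) xN.
  exact: (@leq_bigmax_seq _ (enum_fset D) xpredT id n nD isT).
by have [_] := fS N; apply.
Qed.

(* ||X|| = |H_0 X| - 1; see [stature_rank] for the other formula. *)
Definition stature (X : topologicalType) (nX : noetherian X) : ord :=
  opred (ordinal_rank (hoare0_wf nX)).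
Arguments stature : clear implicits.

Definition irreducible (X : topologicalType) (C : set X) : Prop :=
  C !=set0 /\
  forall F1 F2 : set X, closed F1 -> closed F2 ->
    C `<=` F1 `|` F2 -> C `<=` F1 \/ C `<=` F2.

Definition sobrif (X : topologicalType) : Type :=
  {C : hoare0 X | irreducible (C : set X)}.

Definition sobrif_lt (X : topologicalType) (A B : sobrif X) : Prop :=
  hoare0_lt (sval A) (sval B).

Lemma sobrif_wf (X : topologicalType) :
  noetherian X -> well_founded (@sobrif_lt X).
Proof.
by move=> nX; exact: (wf_inverse_image _ _ _ (fun A => sval A) (hoare0_wf nX)).
Qed.

Definition sob (X : topologicalType) (nX : noetherian X) : ord :=
  ordinal_rank (sobrif_wf nX).
Arguments sob : clear implicits.

(* Only meaningful when [X] is non-empty: [sob X nX] is 0 otherwise. *)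
Definition rsob (X : topologicalType) (nX : noetherian X) : ord :=
  opred (sob X nX).
Arguments rsob : clear implicits.

Lemma stature_rank (X : topologicalType) (nX : noetherian X) :
  stature X nX = rank (hoare0_wf nX) (Hoare0 (@closedT X)).
Proof.
rewrite /stature -[RHS]osuccK; congr opred.
apply: ole_antisym; last exact: (osup_ub _ (Hoare0 (@closedT X))).
apply: osup_le => C; apply/ole_succ2.
have [->|CT] := pselect (C = Hoare0 (@closedT X)); first exact: ole_refl.
have ltC : hoare0_lt C (Hoare0 (@closedT X)).
  rewrite /hoare0_lt properEneq; split => //; apply/eqP => E.
  by apply: CT; exact: hoare0_inj.
rewrite [X in ole _ X]rankE.
apply: ole_trans (ole_succ _) _.
exact: (osup_ub _ (exist _ C ltC)).
Qed.

(** * The lifted Hoare powerspace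

    [hoare0V X] has the points of [hoare0 X], the empty set included, and the
    lower Vietoris topology. *)

Definition hoare0V (X : topologicalType) : Type := hoare0 X.

Definition diamond (X : topologicalType) (U : set X) : set (hoare0V X) :=
  [set F | (F : set X) `&` U !=set0].

HB.instance Definition _ (X : topologicalType) := gen_eqMixin (hoare0V X).
HB.instance Definition _ (X : topologicalType) := gen_choiceMixin (hoare0V X).
HB.instance Definition _ (X : topologicalType) :=
  isSubBaseTopological.Build (hoare0V X) (@open X) (@diamond X).
HB.instance Definition _ (X : topologicalType) :=
  isPointed.Build (hoare0V X) (Hoare0 (@closed0 X)).

Lemma hoare0V_openE (X : topologicalType) :
  @open (hoare0V X) =
  [set \bigcup_(i in D) i | D in subset^~ (finI_from (@open X) (@diamond X))].
Proof. by []. Qed.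

Lemma open_diamond (X : topologicalType) (U : set X) :
  open U -> open (diamond U).
Proof.
move=> oU; rewrite hoare0V_openE; exists [set diamond U]; last exact: bigcup_set1.
by move=> _ ->; exact: finI_from1.
Qed.

Lemma hoare0V_noetherian (X : topologicalType) :
  noetherian X -> noetherian (hoare0V X).
Proof.
move=> nX W _; rewrite -compact_cover compact_ultra => F UF FW.
pose S : set (set X) := [set U | open U /\ ~ F (diamond U)].
have oS : open (\bigcup_(U in S) U) by apply: bigcup_open => U [].
have FS : ~ F (diamond (\bigcup_(U in S) U)).
  have [|//|D DS SD] := nX _ oS _ S id; first by move=> U [].
  move=> FD; have {FD} : F (diamond (\bigcup_(U in [set` D]) U)).
    by apply: filterS FD => G [x [Gx /SD]]; exists x.
  have sub U : [set` D] U -> ~ F (diamond U) by move=> /DS; rewrite inE => -[].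
  have : F (\bigcap_(U in [set` D]) ~` diamond U).
    apply: filter_bigI => U /sub.
    by case: (in_ultra_setVsetC (diamond U) UF).
  move=> F1 F2; have [G [/= G1 [x [Gx [U /= UD Ux]]]]] := filter_ex (filterI F1 F2).
  by apply: (G1 U UD); exists x.
have [//|{}FS] := in_ultra_setVsetC (diamond (\bigcup_(U in S) U)) UF.
have [G [WG nG]] := filter_ex (filterI FW FS).
exists G; split => // A; rewrite /= nbhsE => -[B [oB BG] BA]; apply: filterS BA _.
move: oB BG; rewrite hoare0V_openE => -[D DI <-] [E DE EG].
apply: (@filterS _ _ _ E); first by move=> H EH; exists E.
have [K KO KE] := DI _ DE; rewrite -KE; apply: filter_bigI => U UK.
have oU : open U by have := KO _ UK; rewrite inE.
apply: contrapT => nU; apply: nG.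
have : E G by [].
rewrite -KE => /(_ U UK) [x [Gx Ux]]; exists x; split => //.
by exists U.
Qed.

(* Main.v *)
Require Import Defs.
From mathcomp Require Import all_boot finmap.
From mathcomp Require Import all_classical topology.

(** The lower Vietoris topology makes the Hoare powerspace sober, whatever
    [X] is: an irreducible closed set of closed sets is the closure of the
    single point [G], the closure of the union of its members
    ([sobrif_hoare0VE]), and the closure of a point [C] is the set of all
    closed subsets of [C].  The reason is that [G] meets an open set [U]
    exactly when some member meets [U]; irreducibility then turns finitely
    many such members into one, so that every basic neighbourhood of [G] meets
    the given set.

    Consequently [C |-> {F | F `<=` C}] is an isomorphism from the poset of
    closed subsets of [X] onto the sobrification of its Hoare powerspace.  Both
    posets then have the same ordinal rank ([ordinal_rank_le] in the two
    directions), and since the poset of closed subsets has a greatest element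
    [X], its rank is the successor of the rank of [X], which is the stature. *)

Set Implicit Arguments.
Unset Strict Implicit.
Unset Printing Implicit Defensive.

Local Open Scope classical_set_scope.

Lemma rank_le (T T' : Type) (lt : T -> T -> Prop) (lt' : T' -> T' -> Prop)
    (wf : well_founded lt) (wf' : well_founded lt') (f : T -> T') :
  {homo f : x y / lt x y >-> lt' x y} ->
  forall x, ole (rank wf x) (rank wf' (f x)).
Proof.
move=> fP x; elim: (wf x) => {}x _ IH.
rewrite [X in ole X _]rankE [X in ole _ X]rankE; apply: osup_le => -[y yx] /=.
apply: ole_trans (osup_ub _ (exist _ (f y) (fP _ _ yx))) => /=.
by apply/ole_succ2; exact: IH.
Qed.

Lemma ordinal_rank_le (T T' : Type) (lt : T -> T -> Prop)
    (lt' : T' -> T' -> Prop) (wf : well_founded lt) (wf' : well_founded lt')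
    (f : T -> T') :
  {homo f : x y / lt x y >-> lt' x y} ->
  ole (ordinal_rank wf) (ordinal_rank wf').
Proof.
move=> fP; apply: osup_le => x; apply: ole_trans (osup_ub _ (f x)).
by apply/ole_succ2; exact: rank_le.
Qed.

Lemma ordinal_rank_max (T : Type) (lt : T -> T -> Prop)
    (wf : well_founded lt) (top : T) :
  (forall x, x <> top -> lt x top) ->
  ordinal_rank wf = osucc (rank wf top).
Proof.
move=> topP; apply: ole_antisym; last exact: (osup_ub _ top).
apply: osup_le => x; apply/ole_succ2.
have [->|/topP xt] := pselect (x = top); first exact: ole_refl.
rewrite [X in ole _ X]rankE; apply: ole_trans (ole_succ _) _.
exact: (osup_ub _ (exist _ x xt)).
Qed.

Lemma ordinal_rank_hoare0 (X : topologicalType) (nX : noetherian X) :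
  ordinal_rank (hoare0_wf nX) = osucc (stature X nX).
Proof.
rewrite stature_rank; apply: ordinal_rank_max => C CT.
rewrite /hoare0_lt properEneq; split => //; apply/eqP => E.
by apply: CT; exact: hoare0_inj.
Qed.

Lemma irreducible_bigcup (X : topologicalType) (C : set X) (I : choiceType)
    (s : seq I) (F : I -> set X) :
  irreducible C -> (forall i, i \in s -> closed (F i)) ->
  C `<=` \bigcup_(i in [set` s]) F i -> exists2 i, i \in s & C `<=` F i.
Proof.
move=> [[x Cx] irrC]; elim: s => [|a s IH] clF CF; first by have [] := CF x Cx.
have cls : closed (\bigcup_(i in [set` s]) F i).
  rewrite bigcup_seq; apply: closed_bigsetU => i si.
  by apply: clF; rewrite inE si orbT.
have [||Ca|Cs] := irrC (F a) _ _ cls.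
- by apply: clF; rewrite mem_head.
- by move=> y /CF[i /= /[!inE] /predU1P[->|si] Fy]; [left|right; exists i].
- by exists a; rewrite ?mem_head.
- have [i si|i si CFi] := IH _ Cs; first by apply: clF; rewrite inE si orbT.
  by exists i; rewrite ?inE ?si ?orbT.
Qed.

(** Irreducible sets behave like points: they meet a finite intersection of
    open sets as soon as they meet each of them. *)
Lemma irreducible_bigcap (X : topologicalType) (C : set X) (I : choiceType)
    (s : seq I) (U : I -> set X) :
  irreducible C -> (forall i, i \in s -> open (U i)) ->
  (forall i, i \in s -> C `&` U i !=set0) ->
  C `&` \bigcap_(i in [set` s]) U i !=set0.
Proof.
move=> irrC oU CU; apply: contrapT => nCU.
have [i si|x Cx|i si CUi] := @irreducible_bigcup X C I s (fun i => ~` U i) irrC.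
- by apply: open_closedC; exact: oU.
- by rewrite -setC_bigcap => Ux; apply: nCU; exists x.
- by have [x [Cx Ux]] := CU i si; exact: CUi Ux.
Qed.

Definition lower (X : topologicalType) (C : set X) : set (hoare0V X) :=
  [set F | (F : set X) `<=` C].

Lemma lower_closed (X : topologicalType) (C : set X) :
  closed C -> closed (lower C).
Proof.
move=> cC; have -> : lower C = ~` diamond (~` C).
  apply/seteqP; split => F /=; first by move=> FC [x [/FC]].
  by move=> nF x Fx; apply: contrapT => nCx; apply: nF; exists x.
by apply: open_closedC; apply: open_diamond; exact: closed_openC.
Qed.

(** Every subbasic open set [diamond U], hence every open set, is closed under
    passing to a larger closed set of [X]; complements are downward closed. *)
Lemma closed_hoare0V_lower (X : topologicalType) (A : set (hoare0V X))
    (C D : hoare0V X) :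
  closed A -> A C -> (D : set X) `<=` C -> A D.
Proof.
move=> cA AC DC; apply: contrapT => nAD.
have := closed_openC cA; rewrite hoare0V_openE => -[B BI BE].
have [K BK KD] : (\bigcup_(K in B) K) D by rewrite BE.
suff : (~` A) C by [].
rewrite -BE; exists K => //; have [J _ KE] := BI _ BK.
move: KD; rewrite -KE => KD U UJ.
by have [x [Dx Ux]] := KD U UJ; exists x; split => //; exact: DC.
Qed.

(** [lower C] is the closure of the point [C]: a closed set that contains [C]
    contains all of it. *)
Lemma lower_irreducible (X : topologicalType) (C : hoare0 X) :
  irreducible (lower C).
Proof.
split=> [|F1 F2 cF1 cF2 CF]; first by exists C.
by have [FC|FC] := CF C (@subset_refl _ _); [left|right] => D;
  apply: closed_hoare0V_lower FC.
Qed.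

Definition sobrif_lower (X : topologicalType) (C : hoare0 X) :
    sobrif (hoare0V X) :=
  exist _ (Hoare0 (lower_closed (@hoare0_closed X C))) (lower_irreducible C).

Definition hoare0_join (X : topologicalType) (A : set (hoare0V X)) : hoare0 X :=
  Hoare0 (@closed_closure X (\bigcup_(F in A) (F : set X))).

(** Sobriety of the Hoare powerspace.  The members of [A] are below its join,
    so what has to be shown is that the join itself lies in the closed set [A],
    i.e. that each of its basic neighbourhoods meets [A]. *)
Lemma sobrif_hoare0VE (X : topologicalType) (A : set (hoare0V X)) :
  closed A -> irreducible A -> A = lower (hoare0_join A).
Proof.
move=> cA irrA; apply/seteqP; split => [F AF|F].
  by apply: subset_trans (@subset_closure _ _) => x Fx; exists F.
apply: closed_hoare0V_lower => //; apply: contrapT => nAJ.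
have := closed_openC cA; rewrite hoare0V_openE => -[B BI BE].
have [K BK KJ] : (\bigcup_(K in B) K) (hoare0_join A) by rewrite BE.
have [J JO KE] := BI _ BK; rewrite -KE in KJ.
have oU U : U \in J -> open U by move=> /JO; rewrite inE.
have [U /oU/open_diamond//|U UJ|G [AG KG]] :=
  @irreducible_bigcap _ A _ J (@diamond X) irrA.
  (* An open set that meets the closure of a union meets one of its terms. *)
  have [x [clx Ux]] := KJ U UJ.
  have [y [[F' AF' F'y] Uy]] := clx U (open_nbhs_nbhs (conj (oU U UJ) Ux)).
  by exists F'; split => //; exists y.
suff : (~` A) G by [].
by rewrite -BE; exists K => //; rewrite -KE.
Qed.

Lemma sobrif_lower_lt (X : topologicalType) :
  {homo @sobrif_lower X : C D / hoare0_lt C D >-> sobrif_lt C D}.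
Proof.
move=> C D [CD nDC]; split => [F FC|DC]; first exact: subset_trans FC CD.
exact: (nDC (DC D (@subset_refl _ _))).
Qed.

(** The join is strictly increasing because an irreducible closed set is
    recovered from its join. *)
Lemma hoare0_join_lt (X : topologicalType) :
  {homo (fun A : sobrif (hoare0V X) => hoare0_join (sval A)) : A B /
     sobrif_lt A B >-> hoare0_lt A B}.
Proof.
move=> [[A cA] irrA] [[B cB] irrB] [/= AB nBA]; split => [|BA] /=.
  by apply: closureS; exact: bigcup_subset.
apply: nBA; rewrite (sobrif_hoare0VE cA irrA) (sobrif_hoare0VE cB irrB) => F FB.
exact: subset_trans FB BA.
Qed.

Theorem theorem11p1 (X : topologicalType) (nX : noetherian X) :
  sob (hoare0V X) (hoare0V_noetherian nX) = osucc (stature X nX) /\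
  rsob (hoare0V X) (hoare0V_noetherian nX) = stature X nX.
Proof.
suff E : sob (hoare0V X) (hoare0V_noetherian nX) = osucc (stature X nX).
  by split => //; rewrite /rsob E osuccK.
rewrite -ordinal_rank_hoare0; apply: ole_antisym.
- exact: ordinal_rank_le (@hoare0_join_lt X).
- exact: ordinal_rank_le (@sobrif_lower_lt X).
Qed.
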